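(* Let $a>b>0$, $c=\sqrt{a^2-b^2}$, and let $A_1=(c,0)$, a focus of the ellipse $\vec r(\theta)=(a\cos\theta,b\sin\theta)$, $0\le\theta\le2\pi$. Let $P=P(\theta)=(a\cos\theta,b\sin\theta)$ be the moving point on this ellipse with parameter $\theta$. Then: (i) For $\mathcal{D}=|\overrightarrow{A_1P}|$, we have $$\frac{d^2\mathcal{D}}{d\theta^2}=\frac{-(ac\sin\theta-c^2\sin\theta\cos\theta)^2+[(a\cos\theta-c)^2+b^2\sin^2\theta]\,(ac\cos\theta-c^2\cos2\theta)}{[(a\cos\theta-c)^2+b^2\sin^2\theta]^{3/2}},$$ $$\frac{d\mathcal{D}}{d\theta}\Big|_{\theta=0}=0,\qquad \mathcal{D}|_{\theta=0}=a-c.$$ (ii) The rotational speed of $\overrightarrow{A_1P}$ with respect to $\theta$ is $$\frac{b(a-c\cos\theta)}{(a\cos\theta-c)^2+b^2\sin^2\theta}.$$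
   Context: For a nowhere-zero differentiable vector function $\vec w(\theta)$, with $\vec e_{\vec w}=\vec w/|\vec w|$, the rotational speed of $\vec w$ with respect to $\theta$ is $\left|\frac{d\vec e_{\vec w}}{d\theta}\right|$. The parameter $\theta$ may also be taken to range over $(-\infty,+\infty)$. *)

(* Defs.v *)
From Stdlib Require Import Reals.
From Coquelicot Require Import Coquelicot.
Open Scope R_scope.

(* On R * R, Coquelicot's [norm] is the Euclidean norm
   [sqrt (norm x ^ 2 + norm y ^ 2)]. *)
Definition vec (A B : R * R) : R * R := minus B A.

Definition ellipse (a b theta : R) : R * R := (a * cos theta, b * sin theta).

Definition unit_vec (w : R -> R * R) (theta : R) : R * R :=
  scal (/ norm (w theta)) (w theta).

(* [speed] is the rotational speed of [w] over the parameter range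
   (-oo, +oo); the first two clauses are the conditions under which the
   notion is defined. *)
Definition is_rotational_speed (w : R -> R * R) (speed : R -> R) : Prop :=
  (forall theta, w theta <> zero) /\
  (forall theta, ex_derive w theta) /\
  (forall theta, exists l : R * R,
     is_derive (unit_vec w) theta l /\ norm l = speed theta).

(* Main.v *)
(* The ellipse equation gives |A1 P| = a - c cos theta, so the second
   derivative of D is c cos theta.  The unit vector along A1 P then has derivative
   b / (a - c cos theta)^2 * (- b sin theta, a cos theta - c),
   of norm b / (a - c cos theta). *)
Require Import Defs.
From Stdlib Require Import Reals Lra.
From Coquelicot Require Import Coquelicot.
Open Scope R_scope.

(** Writing the pair as [f t * (1, 0) + g t * (0, 1)] reduces the claim to the rules for sums and
    for scaling a fixed vector. *)
Lemma is_derive_pair (f g : R -> R) (x l m : R) :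
  is_derive f x l -> is_derive g x m ->
  is_derive (fun t => (f t, g t) : R * R) x ((l, m) : R * R).
Proof.
intros Hf Hg.
assert (E : forall u v : R,
          plus (scal u ((1, 0) : R * R)) (scal v ((0, 1) : R * R)) = (u, v)).
{ intros u v; unfold plus, scal; simpl; unfold prod_plus, prod_scal; simpl.
  unfold plus, scal; simpl; unfold mult; simpl; f_equal; ring. }
rewrite <- E.
apply is_derive_ext with
  (f := fun t => plus (scal (f t) ((1, 0) : R * R)) (scal (g t) ((0, 1) : R * R))).
{ intros t; apply E. }
apply @is_derive_plus; apply @is_derive_scal_l; assumption.
Qed.

Lemma norm_pair (x y : R) : norm ((x, y) : R * R) = sqrt (x ^ 2 + y ^ 2).
Proof.
change (sqrt (Rabs x ^ 2 + Rabs y ^ 2) = sqrt (x ^ 2 + y ^ 2)).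
now rewrite !RPow_abs, !Rabs_pos_eq by apply pow2_ge_0.
Qed.

(** Turns the 3/2 power in the stated second derivative into a cube, once its base is recognised as
    a square. *)
Lemma Rpower_sqr_3_2 (x : R) : 0 < x -> Rpower (x ^ 2) (3 / 2) = x ^ 3.
Proof.
intros Hx.
rewrite <- (Rpower_pow 2 x Hx), <- (Rpower_pow 3 x Hx), Rpower_mult.
f_equal; simpl; field.
Qed.

Section FocalDistance.

Variables a b c : R.
Hypothesis hb : 0 < b.
Hypothesis hab : b < a.
Hypothesis hc : c = sqrt (a ^ 2 - b ^ 2).

Lemma focal_sqr : c ^ 2 = a ^ 2 - b ^ 2.
Proof. rewrite hc; apply pow2_sqrt; nra. Qed.

Lemma focal_ge0 : 0 <= c.
Proof. rewrite hc; apply sqrt_pos. Qed.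

Lemma focal_distance_gt0 (t : R) : 0 < a - c * cos t.
Proof.
pose proof focal_sqr; pose proof focal_ge0; pose proof (COS_bound t).
(* Since [b > 0], [c ^ 2 < a ^ 2]; then [c * cos t <= c < a]. *)
assert (c < a) by nra.
nra.
Qed.

(** After eliminating [sin t] and [b], both sides are polynomials in [a], [c] and [cos t], and the
    terms [a ^ 2 * cos t ^ 2] and [c ^ 2] cancel on the left. *)
Lemma focal_distance_sqr (t : R) :
  (a * cos t - c) ^ 2 + b ^ 2 * sin t ^ 2 = (a - c * cos t) ^ 2.
Proof.
pose proof focal_sqr as Hc; pose proof (sin2_cos2 t) as Ht; unfold Rsqr in Ht.
replace (sin t ^ 2) with (1 - cos t ^ 2) by (simpl; lra).
replace (b ^ 2) with (a ^ 2 - c ^ 2) by lra.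
ring.
Qed.

Lemma vec_focus_ellipse (t : R) :
  vec (c, 0) (ellipse a b t) = (a * cos t - c, b * sin t).
Proof.
unfold vec, ellipse, minus, plus, opp; simpl; unfold prod_plus, prod_opp; simpl.
unfold plus, opp; simpl; f_equal; ring.
Qed.

Lemma norm_vec_focus_ellipse (t : R) :
  norm (vec (c, 0) (ellipse a b t)) = a - c * cos t.
Proof.
rewrite vec_focus_ellipse, norm_pair, Rpow_mult_distr, focal_distance_sqr.
apply sqrt_pow2, Rlt_le, focal_distance_gt0.
Qed.

Lemma is_derive_focal_distance (t : R) :
  is_derive (fun t => norm (vec (c, 0) (ellipse a b t))) t (c * sin t).
Proof.
apply is_derive_ext with (f := fun t => a - c * cos t).
{ intros s; symmetry; apply norm_vec_focus_ellipse. }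
auto_derive; [exact I | ring].
Qed.

Lemma is_derive_2_focal_distance (t : R) :
  is_derive_n (fun t => norm (vec (c, 0) (ellipse a b t))) 2 t (c * cos t).
Proof.
(* [is_derive_n] at order 2 differentiates the total function [Derive], so the first derivative is
   identified at every point. *)
apply is_derive_ext with (f := fun t => c * sin t).
{ intros s; symmetry; apply is_derive_unique, is_derive_focal_distance. }
auto_derive; [exact I | ring].
Qed.

Lemma is_derive_unit_vec_focus (t : R) :
  is_derive (unit_vec (fun t => vec (c, 0) (ellipse a b t))) t
    ((- b ^ 2 * sin t / (a - c * cos t) ^ 2,
      b * (a * cos t - c) / (a - c * cos t) ^ 2) : R * R).
Proof.
apply is_derive_ext with
  (f := fun t => ((a * cos t - c) / (a - c * cos t), b * sin t / (a - c * cos t)) : R * R).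
{ intros s; unfold unit_vec.
  rewrite norm_vec_focus_ellipse, vec_focus_ellipse.
  unfold scal; simpl; unfold prod_scal; simpl; unfold scal; simpl; unfold mult; simpl.
  unfold Rdiv; f_equal; apply Rmult_comm. }
pose proof (focal_distance_gt0 t) as HD.
apply is_derive_pair; auto_derive; try lra.
(* The quotient rule gives the numerator [- a * sin t * (a - c * cos t) - (a * cos t - c) * (c * sin
   t)], which is [- (a ^ 2 - c ^ 2) * sin t]. *)
- replace (b ^ 2) with (a ^ 2 - c ^ 2) by (rewrite focal_sqr; ring).
  field; lra.
- pose proof (sin2_cos2 t) as Ht; unfold Rsqr in Ht.
  (* The quotient rule yields [c * (sin t ^ 2 + cos t ^ 2)]; inserting that factor 1 lets [field]
     close the goal. *)
  replace (b * (a * cos t - c))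
    with (b * (a * cos t - c * (sin t * sin t + cos t * cos t)))
    by (rewrite Ht; ring).
  field; lra.
Qed.

Lemma rotational_speed_focus :
  is_rotational_speed (fun t => vec (c, 0) (ellipse a b t))
    (fun t => b * (a - c * cos t) / ((a * cos t - c) ^ 2 + b ^ 2 * sin t ^ 2)).
Proof.
split; [| split]; intros t; pose proof (focal_distance_gt0 t) as HD.
- intros H0.
  pose proof (norm_vec_focus_ellipse t) as HN; rewrite H0 in HN.
  rewrite @norm_zero in HN; lra.
- exists ((- a * sin t, b * cos t) : R * R).
  apply is_derive_ext with (f := fun t => (a * cos t - c, b * sin t) : R * R).
  { intros s; symmetry; apply vec_focus_ellipse. }
  apply is_derive_pair; auto_derive; try exact I; ring.
- eexists; split; [apply is_derive_unit_vec_focus |].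
  rewrite norm_pair, focal_distance_sqr.
  replace (b * (a - c * cos t) / (a - c * cos t) ^ 2)
    with (b / (a - c * cos t)) by (field; lra).
  (* Factoring out [b ^ 2] from the sum of squares leaves the squared focal distance again. *)
  replace ((- b ^ 2 * sin t / (a - c * cos t) ^ 2) ^ 2 +
           (b * (a * cos t - c) / (a - c * cos t) ^ 2) ^ 2)
    with (b ^ 2 * ((a * cos t - c) ^ 2 + b ^ 2 * sin t ^ 2) / (a - c * cos t) ^ 4)
    by (field; lra).
  rewrite focal_distance_sqr.
  replace (b ^ 2 * (a - c * cos t) ^ 2 / (a - c * cos t) ^ 4)
    with ((b / (a - c * cos t)) ^ 2) by (field; lra).
  apply sqrt_pow2, Rlt_le, Rdiv_lt_0_compat; assumption.
Qed.

End FocalDistance.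

Theorem proposition5p4 (a b c : R) (hb : 0 < b) (hab : b < a)
    (hc : c = sqrt (a ^ 2 - b ^ 2)) :
  let A1 : R * R := (c, 0) in
  let P : R -> R * R := ellipse a b in
  let D : R -> R := fun theta => norm (vec A1 (P theta)) in
  ((forall theta, ex_derive D theta) /\
   (forall theta,
      is_derive_n D 2 theta
        ((- (a * c * sin theta - c ^ 2 * sin theta * cos theta) ^ 2
          + ((a * cos theta - c) ^ 2 + b ^ 2 * (sin theta) ^ 2)
            * (a * c * cos theta - c ^ 2 * cos (2 * theta)))
         / Rpower ((a * cos theta - c) ^ 2 + b ^ 2 * (sin theta) ^ 2) (3 / 2))) /\
   is_derive D 0 0 /\
   D 0 = a - c) /\
  is_rotational_speed (fun theta => vec A1 (P theta))
    (fun theta =>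
       b * (a - c * cos theta)
       / ((a * cos theta - c) ^ 2 + b ^ 2 * (sin theta) ^ 2)).
Proof.
intros A1 P D.
split; [| exact (rotational_speed_focus a b c hb hab hc)].
pose proof (is_derive_focal_distance a b c hb hab hc) as HD'.
split; [| split; [| split]].
- intros t; eexists; apply HD'.
- intros t.
  pose proof (focal_distance_gt0 a b c hb hab hc t) as HD.
  rewrite (focal_distance_sqr a b c hb hab hc), (Rpower_sqr_3_2 _ HD), cos_2a.
  (* With [r = a - c * cos t], the numerator is [- (c * sin t * r) ^ 2 + r ^ 2 * (c * cos t * r + c
     ^ 2 * sin t ^ 2)], that is [c * cos t * r ^ 3]. *)
  replace (_ / _) with (c * cos t) by (field; lra).
  exact (is_derive_2_focal_distance a b c hb hab hc t).
- specialize (HD' 0); rewrite sin_0, Rmult_0_r in HD'; exact HD'.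
- unfold D, P, A1.
  rewrite (norm_vec_focus_ellipse a b c hb hab hc), cos_0; ring.
Qed.
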